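(* The integrality gap of the linear programming relaxation (LP1) (defined in the context) of the minimum latency problem is at most $10.78$; that is, for every instance, the optimal value of the minimum latency problem is at most $10.78$ times the optimal value of (LP1).
   Context: Minimum latency problem (ML): let $G=(\mathcal D\cup\{r\},E)$ be the complete graph on $N=|\mathcal D|+1$ nodes with edge weights $\{d_e\}$ forming a metric (with integer values). Find a path starting at $r$ and visiting all nodes of $\mathcal D$ that minimizes the sum over $j\in\mathcal D$ of the latency of $j$, i.e. the length of the path from $r$ to $j$. Let $T$ be an integer upper bound on the maximum latency of a node in an optimal solution; $t$ ranges over $\{1,\dots,T\}$. For $S\subseteq\mathcal D$, $\delta(S)$ is the set of edges with exactly one endpoint in $S$. (LP1) has variables $x_{j,t}\ge0$ ($j\in\mathcal D$) and $z_{e,t}\ge0$ ($e\in E$), where $x_{j,t}=0$ whenever $d_{jr}>t$: minimize $\sum_{j,t}t\,x_{j,t}$ subject to $\sum_tx_{j,t}\ge1$ for all $j$; $\sum_ed_ez_{e,t}\le t$ for all $t$; $\sum_{e\in\delta(S)}z_{e,t}\ge\sum_{t'\le t}x_{j,t'}$ for all $t$, all $S\subseteq\mathcal D$ and all $j\in S$. *)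

(* Defs.v *)
From HB Require Import structures.
From mathcomp Require Import all_boot all_order all_algebra.
From mathcomp Require Import boolp classical_sets reals constructive_ereal ereal.

Set Implicit Arguments.
Unset Strict Implicit.
Unset Printing Implicit Defensive.

Import Order.TTheory GRing.Theory Num.Theory.

(* An instance consists of a finite type [D] of clients and integer weights
   on the edges of the complete graph with node set [option D], where [None]
   is the root r and [Some j] the client j.  An edge is a set of two nodes;
   functions on edges have domain [{set option D}], and only their values on
   two-element sets are ever used. *)

Section Instance.
Variable D : finType.
Implicit Types (d : {set option D} -> nat) (u v w : option D).
Implicit Types (s : seq D) (S : {set D}) (j : D).

Definition edges : {set {set option D}} := [set e : {set option D} | #|e| == 2]%SET.

Definition cut S : {set {set option D}} :=
  [set e in edges | #|e :&: (@Some D @: S)| == 1]%SET.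

Definition dist d u v : nat := if u == v then 0 else d [set u; v]%SET.

(* Symmetry and [dist d u u = 0] hold by construction. *)
Definition is_metric d : Prop :=
  (forall u v, u != v -> 0 < dist d u v) /\
  (forall u v w, dist d u w <= dist d u v + dist d v w).

Fixpoint path_length d u (p : seq (option D)) : nat :=
  if p is v :: p' then dist d u v + path_length d v p' else 0.

(* The path r, s_1, s_2, ... is represented by the sequence s of its clients. *)
Definition is_route s : Prop := uniq s /\ forall j, j \in s.

Definition latency d s j : nat :=
  path_length d None [seq Some i | i <- take (index j s).+1 s].

Definition total_latency d s : nat := \sum_(j : D) latency d s j.

Definition is_optimal_route d s : Prop :=
  is_route s /\
  forall s', is_route s' -> total_latency d s <= total_latency d s'.

Section Relaxation.
Variable R : realType.
Local Open Scope ring_scope.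

Definition ml_opt d : \bar R :=
  ereal_inf [set (total_latency d s)%:R%:E | s in is_route]%classic.

Record lp1_feasible d (T : nat) (x : D -> nat -> R)
    (z : {set option D} -> nat -> R) : Prop := Lp1Feasible {
  lp1_x_ge0 : forall j t, (1 <= t <= T)%N -> 0 <= x j t;
  lp1_z_ge0 : forall e t, e \in edges -> (1 <= t <= T)%N -> 0 <= z e t;
  lp1_x_far : forall j t, (1 <= t <= T)%N ->
    (t < dist d (Some j) None)%N -> x j t = 0;
  lp1_visit : forall j, 1 <= \sum_(1 <= t < T.+1) x j t;
  lp1_budget : forall t, (1 <= t <= T)%N ->
    \sum_(e in edges) (d e)%:R * z e t <= t%:R;
  lp1_cut : forall t S j, (1 <= t <= T)%N -> j \in S ->
    \sum_(1 <= t' < t.+1) x j t' <= \sum_(e in cut S) z e t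
}.

Definition lp1_cost (T : nat) (x : D -> nat -> R) : R :=
  \sum_(j : D) \sum_(1 <= t < T.+1) t%:R * x j t.

Definition lp1_opt d (T : nat) : \bar R :=
  ereal_inf [set c | exists x z,
    lp1_feasible d T x z /\ c = (lp1_cost T x)%:E]%classic.

End Relaxation.
End Instance.

(* Main.v *)
Require Import Defs.
From HB Require Import structures.
From mathcomp Require Import all_boot all_order all_algebra.
From mathcomp Require Import boolp classical_sets reals constructive_ereal ereal.
From mathcomp Require Import zify ring lra.

(* Fix a feasible solution of (LP1) and let g(t) be the total fraction of
   clients not yet visited at time t.  The Goemans-Williamson moat growing
   argument for the prize-collecting Steiner tree, with uniform penalties,
   yields for all t and lam > 0 a tree of cost c missing m clients with
   c + lam m <= 2t + lam g(t); doubling it gives a tour of length 2c.  The moats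
   are never recorded as a dual solution: each growth step is charged directly
   to the cut constraints of the fractional solution.

   Tours are concatenated for the times t, 4t, 16t, ..., each traversed in its
   better direction, so that a tour of length 2c started with n unvisited
   clients costs at most c (n + m).  If b bounds the cost per client of the next
   stage, the choice lam = (2t + b) / (g(t) + n) and AM-GM give
   (c + b) (m + n) <= (2t + b) (g(t) + n), which telescopes to a route of total
   latency at most 2 t |D| + 10 sum_i (4^i t) g(4^i t).  Averaging t = 1 and
   t = 2 and comparing the dyadic sum with the cost of (LP1), which is at least
   sum_t g(t), yields the factor 10. *)

Import Order.TTheory GRing.Theory Num.Theory.

(** * Rooted trees in a contracted graph *)

Section PrizeCollecting.
Set Implicit Arguments.
Unset Strict Implicit.
Import fintype finset.
Local Open Scope ring_scope.
Variables (R : realFieldType) (V : finType) (r : V).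
Implicit Types (f : V -> V) (l : V -> V -> R) (w q : V -> R).
Implicit Types (F : {set V}) (E : seq (V * V)).

(** [F] holds the labels of the components reached from [r]. The edges of [E] point away from [r]
    and are kept as pairs of original vertices, not of labels, so that they survive when components
    are merged or split. *)
Inductive ctree f : {set V} -> seq (V * V) -> Prop :=
| ctree_root : ctree f [set r] [::]
| ctree_leaf F E x y : ctree f F E -> f x \in F -> f y \notin F ->
    ctree f (f y |: F) ((x, y) :: E).

Definition weight l E : R := \sum_(e <- E) l e.1 e.2.

Lemma weight_cons l e E : weight l (e :: E) = l e.1 e.2 + weight l E.
Proof. by rewrite /weight big_cons. Qed.

Lemma ctree_rootP f F E : ctree f F E -> r \in F.
Proof. by elim=> [|F' E' x y _ rF _ _]; rewrite !inE ?eqxx ?rF ?orbT. Qed.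

Lemma ctree_sub f F E : f r = r -> (forall x, f (f x) = f x) ->
  ctree f F E -> forall x, x \in F -> f x = x.
Proof.
move=> fr ff; elim=> [x|F' E' x y _ IH _ _ u]; rewrite !inE; first by move/eqP->.
by case/orP=> [/eqP->//|/IH].
Qed.

Lemma ctree_edge f F E : ctree f F E ->
  forall e, e \in E -> f e.1 != f e.2 /\ f e.1 \in F.
Proof.
elim=> [//|F' E' x y _ IH xF yF e]; rewrite !inE => /orP[/eqP->/=|/IH[-> ->]].
  by rewrite xF orbT; split=> //; apply: contraNneq yF => <-.
by rewrite orbT.
Qed.

Lemma ctree_children f F E : ctree f F E ->
  uniq [seq f e.2 | e <- E] /\ [seq f e.2 | e <- E] =i F :\ r.
Proof.
elim=> [|F' E' x y tr [un ch] xF yF]; first by split=> // u; rewrite !inE andNb.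
have yr : f y != r by apply: contraNneq yF => ->; exact: ctree_rootP tr.
split=> /= [|u]; first by rewrite un ch !inE yr (negbTE yF).
by rewrite !inE ch !inE; case: (eqVneq u (f y)) => [->|//]; rewrite yr.
Qed.

Lemma ctree_size f F E : ctree f F E -> size E = #|F :\ r|.
Proof.
move=> tr; have [un ch] := ctree_children tr.
by rewrite -(size_map (fun e => f e.2)) -(card_uniqP un); apply: eq_card.
Qed.

Lemma ctree_prune f F E x : ctree f F E -> x \in F -> x != r ->
  (forall e, e \in E -> f e.1 != x) ->
  exists E', [/\ ctree f (F :\ x) E', subseq E' E & size E' < size E]%N.
Proof.
move=> tr; elim: tr x => [x|F' E' a b tr IH aF bF x].
  by rewrite inE => ->.
rewrite inE => xF xr ch; case: (eqVneq x (f b)) xF => [xb _|xb].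
  exists E'; split=> //=; last exact: subseq_cons.
  by rewrite xb setU1K.
rewrite inE (negbTE xb) => /= xF.
have [|E2 [tr2 s2 z2]] := IH x xF xr.
  by move=> e eE; apply: ch; rewrite inE eE orbT.
exists ((a, b) :: E2); split=> //=; last by rewrite eqxx.
have -> : (f b |: F') :\ x = f b |: (F' :\ x).
  by apply/setP=> u; rewrite !inE; case: (eqVneq u (f b)) => // ->; rewrite eq_sym xb.
apply: ctree_leaf => //; last by rewrite !inE (negbTE bF) andbF.
by rewrite !inE aF andbT; apply: (ch (a, b)); rewrite inE eqxx.
Qed.

Lemma le_weight_subseq f F E E' l : ctree f F E -> subseq E' E ->
  (forall x y, f x != f y -> 0 <= l x y) -> weight l E' <= weight l E.
Proof.
move=> tr sE l0; have {tr} : forall e, e \in E -> 0 <= l e.1 e.2.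
  by move=> e /(ctree_edge tr)[ne _]; apply: l0.
elim: E E' sE => [|e E IH] [|e' E'] //= sE pos.
- by rewrite /weight big_nil big_seq; apply: sumr_ge0 => i; apply: pos.
- have posE : forall i, i \in E -> 0 <= l i.1 i.2.
    by move=> i iE; apply: pos; rewrite inE iE orbT.
  move: sE; case: eqP => [->|_] sE; rewrite ?weight_cons ?lerD2l; first exact: IH.
  have := IH _ sE posE; rewrite weight_cons => h.
  by apply: (le_trans h); rewrite lerDr pos // inE eqxx.
Qed.

(** Leaves outside [A] are deleted as long as there are any. At the end every component other than
    [r] and outside [A] has a child, which is what the degree count needs. *)
Lemma ctree_pruned f F E l (A : {set V}) : ctree f F E ->
  (forall x y, f x != f y -> 0 <= l x y) ->
  exists F' E', [/\ ctree f F' E', F' \subset F, F :&: A \subset F',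
    weight l E' <= weight l E &
    forall x, x \in F' -> x != r -> x \notin A -> x \in [seq f e.1 | e <- E']].
Proof.
move=> tr l0; have [n] := ubnP (size E); elim: n F E tr => // n IH F E tr En.
case: (pickP [pred x in F :\ r | (x \notin A) && (x \notin [seq f e.1 | e <- E])]).
  move=> x /= /andP[]; rewrite !inE => /andP[xr xF] /andP[xA xE].
  have [|E2 [tr2 sE zE]] := ctree_prune tr xF xr.
    by move=> e eE; apply: contraNneq xE => <-; apply: map_f.
  have [|F' [E' [tr' sF sA lE ch]]] := IH _ _ tr2; first exact: leq_trans zE _.
  exists F', E'; split=> //.
  - exact: (subset_trans sF (subsetDl _ _)).
  - apply: subset_trans sA; apply/subsetP => u; rewrite !inE => /andP[-> uA].
    by rewrite uA !andbT; apply: contraNneq xA => <-.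
  - exact: (le_trans lE (le_weight_subseq tr sE l0)).
move=> none; exists F, E; split=> //; first exact: subsetIl.
move=> x xF xr xA; have := none x; rewrite /= !inE xr xF xA /=.
by move/negbFE.
Qed.

Definition act f w : {set V} := [set a | [&& f a == a, a != r & 0 < w a]].

(** Heads and tails are counted separately. Each component other than [r] is the head of exactly one
    edge, so at most [#|A :&: F|] heads lie in [A]. The edges are as many as the components other
    than [r], and each of these outside [A] is the tail of some edge, so again at most [#|A :&: F|]
    tails are left for [A]. *)
Lemma ctree_degree f F E (A : {set V}) : ctree f F E -> r \notin A ->
  (forall x, x \in F -> x != r -> x \notin A -> x \in [seq f e.1 | e <- E]) ->
  (\sum_(e <- E) ((f e.1 \in A) + (f e.2 \in A)) <= 2 * #|A :&: F|)%N.
Proof.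
move=> tr rA ch; have [un chE] := ctree_children tr.
have sumE (P : pred (V * V)) : (\sum_(e <- E) P e = count P E)%N.
  by rewrite -sum1_count [RHS]big_mkcond; apply: eq_bigr => e _; case: (P e).
rewrite big_split /= mulSn mul1n (sumE (fun e => f e.1 \in A)) (sumE (fun e => f e.2 \in A)).
apply: leq_add; last first.
  rewrite -(count_map (fun e => f e.2) (mem A)) -size_filter -(card_uniqP _) ?filter_uniq //.
  by apply: subset_leq_card; apply/subsetP => u; rewrite mem_filter chE !inE => /and3P[-> _ ->].
have e1 : (count (fun e => f e.1 \in A) E + count (fun e => f e.1 \notin A) E = size E)%N.
  exact: (count_predC (fun e => f e.1 \in A)).
have e2 : (#|(F :\ r) :\: A| <= count (fun e => f e.1 \notin A) E)%N.
  rewrite -(count_map (fun e => f e.1) (fun x => x \notin A)) -size_filter.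
  rewrite cardE; apply: uniq_leq_size; first exact: enum_uniq.
  move=> u; rewrite mem_enum mem_filter !inE => /and3P[uA ur uF].
  by rewrite uA ch.
have e3 : #|A :&: F| = #|(F :\ r) :&: A|.
  apply: eq_card => u; rewrite !inE andbC; case: (eqVneq u r) => // ->.
  by rewrite (negbTE rA) andbF.
rewrite e3 -(leq_add2r #|(F :\ r) :\: A|) cardsID -(ctree_size tr) -e1.
by rewrite leq_add2l.
Qed.

(** Undoes a contraction: if the tree meets the merged component, the edge between [x0] and [y0],
    free in [l], reconnects its two halves. *)
Lemma ctree_merge f a b x0 y0 F E :
  f r = r -> f x0 = a -> f y0 = b -> a != b -> b != r ->
  ctree (fun x => if f x == b then a else f x) F E ->
  exists E', ctree f (if a \in F then b |: F else F) E' /\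
    forall l, l x0 y0 = 0 -> l y0 x0 = 0 -> weight l E' = weight l E.
Proof.
move=> fr fx fy ab br; set f' := fun x => _ => tr.
have addb F1 E1 : ctree f F1 E1 -> a \in F1 -> b \notin F1 -> 
    ctree f (b |: F1) ((x0, y0) :: E1).
  by move=> t aF bF; rewrite -fy; apply: ctree_leaf; rewrite ?fx ?fy.
have bF F1 E1 : ctree f' F1 E1 -> b \notin F1.
  elim=> [|F2 E2 x y _ IH _ _]; rewrite !inE // negb_or IH andbT /f'.
  by case: (eqVneq (f y) b) => [_|]; rewrite eq_sym.
elim: tr => [|F1 E1 x y tr [E2 [tr2 we]] xF yF].
  rewrite inE; case: eqP => [ar|_]; last by exists [::]; split; [exact: ctree_root|].
  exists [:: (x0, y0)]; split; last by move=> l l1 _; rewrite weight_cons /= l1 add0r.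
  by apply: addb; rewrite ?inE ?ar //; exact: ctree_root.
have bF1 := bF _ _ tr.
set F2 := if a \in F1 then _ else _ in tr2.
have xF2 : f x \in F2.
  move: xF; rewrite /f' /F2; case: (eqVneq (f x) b) => [-> ->|_ xF].
    by rewrite !inE eqxx.
  by case: ifP; rewrite ?inE xF ?orbT.
(* Here the tree enters the merged component on the side of [b], so the free edge is used from [y0]
   to [x0] to reach [a]. *)
move: yF; rewrite /f' -/f'; case: (eqVneq (f y) b) => [yb|yb] yF.
  have F2E : F2 = F1 by rewrite /F2 (negbTE yF).
  rewrite F2E in tr2 xF2; rewrite !inE eqxx /=.
  exists ((y0, x0) :: (x, y) :: E2); split; last first.
    by move=> l l1 l2; rewrite !weight_cons /= l2 add0r we.
  have -> : b |: (a |: F1) = f x0 |: (f y |: F1) by rewrite fx yb finset.setUCA.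
  apply: ctree_leaf; first by apply: ctree_leaf; rewrite ?yb.
    by rewrite fy yb !inE eqxx.
  by rewrite fx yb !inE negb_or ab.
have yF2 : f y \notin F2.
  by rewrite /F2; case: ifP => _; rewrite ?inE ?negb_or ?yb.
have tr3 := ctree_leaf tr2 xF2 yF2.
rewrite in_setU1; case: (eqVneq a (f y)) => [ay|ay] /=.
  exists ((x0, y0) :: (x, y) :: E2); split; last first.
    by move=> l l1 l2; rewrite !weight_cons /= l1 add0r we.
  have F2E : F2 = F1 by rewrite /F2 ay (negbTE yF).
  rewrite F2E in tr3; apply: addb => //; first by rewrite ay !inE eqxx.
  by rewrite !inE negb_or bF1 andbT eq_sym.
exists ((x, y) :: E2); split; last by move=> l l1 l2; rewrite !weight_cons we.
by move: tr3; rewrite /F2; case: ifP => _ //; rewrite finset.setUCA.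
Qed.


(** * Moat growing against a fractional solution *)

Section Growth.
Variables (z : V -> V -> R) (q : V -> R).
Hypothesis z_ge0 : forall x y, 0 <= z x y.
Hypothesis z_sym : forall x y, z x y = z y x.
Hypothesis q_ge0 : forall x, 0 <= q x.
Hypothesis q_root : q r = 0.
Hypothesis z_cut : forall (S : {set V}) j, r \notin S -> j \in S ->
  1 - q j <= \sum_(x in S) \sum_(y in ~: S) z x y.

(* A stage of the moat growing algorithm: the components are the fibres of
   [f], the label of a component being its vertex with the least [q]; [l] is
   the reduced cost of the edges and [w] the remaining penalty of the
   components. *)
Record stage f l w : Prop := Stage {
  stage_idem : forall x, f (f x) = f x;
  stage_root : f r = r;
  stage_l_ge0 : forall x y, f x != f y -> 0 <= l x y;
  stage_l_sym : forall x y, l x y = l y x;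
  stage_w_ge0 : forall a, 0 <= w a }.

Definition labels f : {set V} := [set a | f a == a].

(** Ordered pairs count each edge twice, so this is twice the fractional prize-collecting value of
    [z] and [q] at the reduced costs. In [good_tree] the missed penalties also carry the factor 2:
    only the edge cost loses a factor against the relaxation. *)
Definition lp_value f l w : R :=
  \sum_x \sum_(y | f x != f y) l x y * z x y + 2 * \sum_(a in labels f) w a * q a.

Definition good_tree f l w : Prop := exists F E, ctree f F E /\
  weight l E + 2 * \sum_(a in labels f :\: F) w a <= lp_value f l w.

(** A tree for the merged stage lifts at no cost, and missing the merged component means missing
    both halves, whose penalties add up. The fractional side can only grow when the merge is undone:
    edges inside the merged component have nonnegative reduced cost, and the surviving label has the
    smaller [q]. *)
Lemma merge_step f l w x0 y0 : stage f l w ->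
  f x0 != f y0 -> f y0 != r -> q (f x0) <= q (f y0) -> l x0 y0 = 0 ->
  let f' x := if f x == f y0 then f x0 else f x in
  let w' a := if a == f x0 then w (f x0) + w (f y0) else w a in
  [/\ stage f' l w', labels f = f y0 |: labels f', f y0 \notin labels f',
    (#|act f' w'| <= #|act f w|)%N & good_tree f' l w' -> good_tree f l w].
Proof.
move=> [ff fr l0 ls w0] ab br qab lxy f' w'.
set a := f x0 in ab qab f' w' *; set b := f y0 in ab br qab f' w' *.
have fa : f a = a by rewrite /a ff.
have fb : f b = b by rewrite /b ff.
have f'b : f' b = a by rewrite /f' fb eqxx.
have f'ne x y : f' x != f' y -> f x != f y.
  by apply: contraNneq => e; rewrite /f' e.
have st' : stage f' l w'.
  split=> //.
  - move=> x; rewrite /f'; case: (eqVneq (f x) b) => [_|e]; last by rewrite ff (negbTE e).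
    by rewrite fa (negbTE ab).
  - by rewrite /f' fr eq_sym (negbTE br).
  - by move=> x y /f'ne; apply: l0.
  - by move=> c; rewrite /w'; case: ifP => _ //; apply: addr_ge0.
have nb : b \notin labels f' by rewrite inE f'b.
have lab : labels f = b |: labels f'.
  apply/setP=> c; rewrite !inE /f'; case: (eqVneq c b) => [->|cb] /=; first by rewrite fb eqxx.
  case: (eqVneq (f c) b) => [e|//]; rewrite e eq_sym (negbTE cb).
  by apply/esym/negbTE; apply: contraNneq ab => e2; rewrite -e -e2 fa.
have aL : a \in labels f' by rewrite inE /f' fa (negbTE ab) eqxx.
have w'E c : c != a -> w' c = w c by rewrite /w' => /negbTE->.
have w'a : w' a = w a + w b by rewrite /w' eqxx.
have lsum (F : {set V}) (G : V -> R) : b \notin F -> 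
    \sum_(c in labels f :\: F) G c = G b + \sum_(c in labels f' :\: F) G c.
  move=> bF; rewrite (big_setD1 b) /=; last by rewrite lab !inE eqxx bF.
  congr (_ + _); apply: eq_bigl => c; rewrite lab !inE.
  by case: (eqVneq c b) => // ->; move: nb; rewrite inE => /negbTE->; rewrite andbF.
split=> //.
  have sub : act f' w' :\ a \subset (act f w) :\ b :\ a.
    apply/subsetP=> c; rewrite !inE => /and4P[ca /eqP fc cr wc].
    have cL : c \in labels f' by rewrite inE fc.
    have cb : c != b by apply: contraNneq nb => <-.
    have : c \in labels f by rewrite lab in_setU1 cL orbT.
    by rewrite !inE ca cb => ->; rewrite cr -w'E.
  rewrite (cardsD1 a (act f' w')) (cardsD1 b (act f w)) (cardsD1 a (_ :\ b)).
  have := subset_leq_card sub; rewrite !inE fa fb !eqxx ab br /= w'a.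
  have ->: f' a == a by move: aL; rewrite inE.
  have wab : 0 < w a + w b -> (0 < w b) || (0 < w a).
    move=> h; case: (ltrP 0 (w b)) => //= hb; apply: (lt_le_trans h).
    by rewrite gerDl.
  case: (a != r) => //=; last by move=> h; rewrite !add0n; apply: leq_trans h (leq_addl _ _).
  case: (ltrP 0 (w a + w b)) => [/wab|_].
    by case: (0 < w b) => //=; [rewrite !add1n ltnS => _ h; apply: leq_trans h (leq_addl _ _)
      |move=> ->; rewrite add0n leq_add2l].
  by move=> h; rewrite add0n addnA; apply: leq_trans h (leq_addl _ _).
move=> [F [E [tr ineq]]].
have [E' [tr' we]] := ctree_merge fr (erefl a) (erefl b) ab br tr.
exists (if a \in F then b |: F else F), E'; split=> //.
have lyx : l y0 x0 = 0 by rewrite ls.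
rewrite (we l lxy lyx).
have bF : b \notin F.
  apply: contra nb => h; rewrite inE; apply/eqP.
  by apply: (ctree_sub _ _ tr h) => //; case: st'.
have -> : \sum_(c in labels f :\: (if a \in F then b |: F else F)) w c =
          \sum_(c in labels f' :\: F) w' c.
  case: ifP => aF.
    apply: eq_big => c; rewrite lab !finset.in_setD !in_setU1.
      by case: (eqVneq c b) => [->|//]; rewrite (negbTE nb) andbF.
    rewrite negb_or => /andP[/andP[_ cF] _]; rewrite w'E //.
    by apply: contraNneq cF => ->.
  rewrite lsum // [RHS](big_setD1 a) ?inE ?aF //=; last by move: aL; rewrite inE.
  rewrite [X in _ + X](big_setD1 a) ?inE ?aF //=; last by move: aL; rewrite inE.
  rewrite w'a addrA [w b + _]addrC; congr (_ + _); apply: eq_bigr => c.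
  by rewrite !inE => /andP[ca _]; rewrite w'E.
apply: (le_trans ineq); rewrite /lp_value; apply: lerD.
  apply: ler_sum => x _; rewrite big_mkcond [leRHS]big_mkcond; apply: ler_sum => y _.
  case: ifP => [/f'ne->//|_]; case: ifP => // e; apply: mulr_ge0 => //; exact: l0.
apply: ler_wpM2l => //.
have -> : \sum_(c in labels f) w c * q c = w b * q b + \sum_(c in labels f') w c * q c.
  by rewrite lab big_setU1.
rewrite !(big_setD1 a aL) /= w'a mulrDl [leRHS]addrA.
have -> : \sum_(c in labels f' :\ a) w' c * q c = \sum_(c in labels f' :\ a) w c * q c.
  by apply: eq_bigr => c; rewrite !inE => /andP[ca _]; rewrite w'E.
by rewrite lerD2r addrC lerD2l; apply: ler_wpM2l.
Qed.

(** The cut constraint is applied to the fibre of each label in [A]. In the sum an edge counts once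
    per endpoint in [A], and passing to ordered pairs doubles both sides. *)
Lemma active_cut f (A : {set V}) : (forall a, a \in A -> f a = a) -> r \notin A ->
  f r = r ->
  2 * \sum_(a in A) (1 - q a) <=
  \sum_x \sum_(y | f x != f y) ((f x \in A) + (f y \in A))%:R * z x y.
Proof.
move=> fA rA fr.
have -> : \sum_x \sum_(y | f x != f y) ((f x \in A) + (f y \in A))%:R * z x y =
    2 * \sum_x \sum_(y | f x != f y) (f x \in A)%:R * z x y.
  under eq_bigr do under eq_bigr do rewrite natrD mulrDl.
  under eq_bigr do rewrite big_split /=.
  rewrite big_split /= mulr2n mulrDl mul1r; congr (_ + _).
  under eq_bigr do rewrite big_mkcond; rewrite exchange_big /=.
  apply: eq_bigr => x _; rewrite -big_mkcond /=; apply: eq_big => [y|y _].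
    by rewrite eq_sym.
  by rewrite z_sym.
apply: ler_wpM2l => //.
rewrite [leRHS](partition_big f predT) //= [leRHS](bigID [in A]) /=.
rewrite -[leLHS]addr0; apply: lerD; last first.
  apply: sumr_ge0 => a _; apply: sumr_ge0 => x _; apply: sumr_ge0 => y _.
  exact: mulr_ge0.
apply: ler_sum => a aA.
have ra : a != r by apply: contraNneq rA => <-.
have rS : r \notin [set x | f x == a] by rewrite inE fr eq_sym.
have aS : a \in [set x | f x == a] by rewrite inE fA.
apply: (le_trans (z_cut rS aS)).
rewrite big_mkcond [leRHS]big_mkcond; apply: ler_sum => x _; rewrite inE.
case: eqP => // fx; rewrite fx aA big_mkcond [leRHS]big_mkcond.
by apply: ler_sum => y _; rewrite !inE eq_sym mul1r.
Qed.

(** Going back from [l'], [w'] to [l], [w], the pruned tree gains at most [2 * eps] per active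
    component it contains, by the degree count, and [2 * eps] per active component it misses, hence
    at most [2 * eps * #|A|] in all. By [active_cut] the fractional side gains at least [2 * eps]
    times the sum of [(1 - q a) + q a] over [A], the same amount. *)
Lemma grow_step f l w eps : 0 <= eps -> stage f l w ->
  let A := act f w in
  let l' x y := l x y - eps * ((f x \in A) + (f y \in A))%:R in
  let w' a := w a - eps * (a \in A)%:R in
  stage f l' w' -> good_tree f l' w' -> good_tree f l w.
Proof.
move=> eps0 [ff fr l0 ls w0] A l' w' [_ _ l0' _ w0'] [F [E [tr ineq]]].
have rA : r \notin A by rewrite inE eqxx andbF.
have [F' [E' [tr' _ FA wE ch]]] := ctree_pruned A tr l0'.
have deg := ctree_degree tr' rA ch.
have rF' := ctree_rootP tr'.
exists F', E'; split=> //.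
have AL a : a \in A -> f a = a by rewrite inE => /andP[/eqP].
have weE : weight l E' <= weight l' E' + eps * (2 * #|A :&: F'|)%:R.
  apply: (@le_trans _ _ (weight l' E' +
      eps * (\sum_(e <- E') ((f e.1 \in A) + (f e.2 \in A)))%:R)).
    rewrite natr_sum mulr_sumr -big_split /=; apply: ler_sum => e _.
    by rewrite /l' subrK.
  by rewrite lerD2l; apply: ler_wpM2l => //; rewrite ler_nat.
(* Pruning drops only inactive components, which have no penalty left. *)
have penF : \sum_(a in labels f :\: F') w' a <= \sum_(a in labels f :\: F) w' a.
  rewrite big_mkcond [leRHS]big_mkcond; apply: ler_sum => a _.
  rewrite !finset.in_setD; case aL: (a \in labels f); rewrite ?andbF // !andbT.
  case aF: (a \in F); case aF': (a \in F') => //=.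
  have ar : a != r by apply: contraFneq aF' => ->.
  have aA : a \notin A.
    apply/negP => aA; move/fintype.subsetP: FA => /(_ a); rewrite inE aF aA aF'.
    by move/(_ isT).
  rewrite /w' (negbTE aA) mulr0 subr0; move: aL aA; rewrite inE => fa.
  by rewrite inE fa ar /= -leNgt.
have penE : \sum_(a in labels f :\: F') w a =
    \sum_(a in labels f :\: F') w' a + eps * #|A :\: F'|%:R.
  have -> : #|A :\: F'|%:R = \sum_(a in labels f :\: F') (a \in A)%:R :> R.
    rewrite -natr_sum; congr _%:R; rewrite -sum1_card big_mkcond [RHS]big_mkcond.
    apply: eq_bigr => a _; rewrite !finset.in_setD.
    case: (a \in F') => //=; case aA: (a \in A); last by case: ifP.
    by rewrite inE AL ?eqxx.
  by rewrite mulr_sumr -big_split /=; apply: eq_bigr => a _; rewrite /w' subrK.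
have lpE : lp_value f l w = lp_value f l' w' +
    eps * (\sum_x \sum_(y | f x != f y) ((f x \in A) + (f y \in A))%:R * z x y) +
    eps * (2 * \sum_(a in A) q a).
  have -> : \sum_(a in A) q a = \sum_(a in labels f) (a \in A)%:R * q a.
    rewrite big_mkcond [RHS]big_mkcond; apply: eq_bigr => a _.
    case aA: (a \in A); first by rewrite inE AL ?eqxx ?mul1r.
    by rewrite mul0r if_same.
  rewrite /lp_value.
  have -> : \sum_x \sum_(y | f x != f y) l x y * z x y =
    \sum_x \sum_(y | f x != f y) l' x y * z x y +
    eps * \sum_x \sum_(y | f x != f y) ((f x \in A) + (f y \in A))%:R * z x y.
    rewrite mulr_sumr -big_split; apply: eq_bigr => x _ /=.
    rewrite mulr_sumr -big_split; apply: eq_bigr => y _ /=.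
    by rewrite mulrA -mulrDl /l' subrK.
  have -> : \sum_(a in labels f) w a * q a = \sum_(a in labels f) w' a * q a +
     eps * \sum_(a in labels f) (a \in A)%:R * q a.
    rewrite mulr_sumr -big_split; apply: eq_bigr => a _ /=.
    by rewrite mulrA -mulrDl /w' subrK.
  by ring.
have := active_cut AL rA fr; rewrite sumrB sumr_const => cut.
have card : (#|A :&: F'| + #|A :\: F'|)%:R = #|A|%:R :> R by rewrite cardsID.
move: (ler_wpM2l eps0 cut) card; rewrite natrD => ecut card.
rewrite penE lpE; move: weE; rewrite natrM => weE.
have ecard : eps * #|A|%:R = eps * #|A :&: F'|%:R + eps * #|A :\: F'|%:R.
  by rewrite -card mulrDr.
nra.
Qed.

(** Growth stops at the first tight constraint. Either a penalty is exhausted and the active set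
    shrinks, or an edge becomes free and two components merge; both decrease the number of labels
    plus the number of active labels. *)
Theorem prize_collecting f l w : stage f l w -> good_tree f l w.
Proof.
have [n] := ubnP (#|labels f| + #|act f w|); elim: n f l w => // n IH f l w size_n st.
have merge f1 l1 w1 x y : stage f1 l1 w1 ->
    (#|labels f1| + #|act f1 w1| <= n)%N -> f1 x != f1 y -> l1 x y = 0 ->
    good_tree f1 l1 w1.
  move=> st1 sz1.
  (* The label with the smaller [q] survives; since [q r = 0], the root can always be the survivor
     of its own merge. *)
  wlog yr : x y / (f1 y != r) && (q (f1 x) <= q (f1 y)).
    move=> wl ne lxy; have lyx : l1 y x = 0 by rewrite (stage_l_sym st1).
    have ne' : f1 y != f1 x by rewrite eq_sym.
    case: (eqVneq (f1 y) r) => [yr|yr].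
      by apply: (wl y x) => //; rewrite -yr ne yr q_root q_ge0.
    case: (eqVneq (f1 x) r) => [xr|xr].
      by apply: (wl x y) => //; rewrite yr xr q_root q_ge0.
    case: (lerP (q (f1 x)) (q (f1 y))) => [|/ltW] h; last by apply: (wl y x); rewrite ?xr.
    by apply: (wl x y); rewrite ?yr.
  case/andP: yr => yr qxy ne lxy.
  have [st2 lab nb le_act] := merge_step st1 ne yr qxy lxy.
  apply; apply: IH => //; move: sz1; rewrite lab cardsU1 nb -addnA add1n.
  by move=> h; apply: leq_ltn_trans h; rewrite leq_add2l.
set A := act f w.
(* The constraints are indexed by a sum type: [inl a] for the penalty of [a], [inr (x, y)] for the
   cost of an edge. The quotient of [num] by [den] is the time at which the constraint becomes
   tight; those with [den] zero do not limit the growth. *)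
pose num (c : V + V * V) := match c with
  | inl a => w a | inr (x, y) => l x y end.
pose den (c : V + V * V) : nat := match c with
  | inl a => (a \in A) | inr (x, y) => if f x != f y then ((f x \in A) + (f y \in A))%N else 0 end.
have num_ge0 c : (0 < den c)%N -> 0 <= num c.
  case: c => [a _|[x y] /=]; first exact: stage_w_ge0 st _.
  by case: ifP => // ne _; apply: (stage_l_ge0 st).
(* With no active component all penalties outside the root are zero, and the tree reduced to [r] is
   good. *)
case: (set_0Vmem A) => [A0|[a0 a0A]].
  exists [set r], [::]; split; first exact: ctree_root.
  rewrite /weight big_nil add0r big1 ?mulr0; last first.
    move=> a; rewrite !inE => /andP[ar la].
    have : a \notin A by rewrite A0 inE.
    rewrite inE la ar /= -leNgt => h; by apply/le_anti; rewrite h (stage_w_ge0 st).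
  apply: addr_ge0.
    apply: sumr_ge0 => x _; apply: sumr_ge0 => y ne; apply: mulr_ge0 => //.
    exact: (stage_l_ge0 st).
  apply: mulr_ge0 => //; apply: sumr_ge0 => a _; apply: mulr_ge0 => //.
  exact: (stage_w_ge0 st).
have den0 : (0 < den (inl a0))%N by rewrite /= a0A.
case: (@arg_minP _ _ _ (inl a0) (fun c => 0 < den c)%N
  (fun c => num c / (den c)%:R) den0) => c den_c min_c.
set eps := num c / (den c)%:R in min_c.
have eps_ge0 : 0 <= eps by apply: divr_ge0; rewrite ?num_ge0.
have tight : num c - eps * (den c)%:R = 0.
  by rewrite /eps divfK ?subrr // pnatr_eq0 -lt0n.
have min_eps c' : (0 < den c')%N -> 0 <= num c' - eps * (den c')%:R.
  by move=> h; rewrite subr_ge0 -ler_pdivlMr ?ltr0n //; apply: min_c.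
pose l' x y := l x y - eps * ((f x \in A) + (f y \in A))%:R.
pose w' a := w a - eps * (a \in A)%:R.
have st' : stage f l' w'.
  case: (st) => ff fr l0 ls w0; split=> //.
  - move=> x y ne; have := min_eps (inr (x, y)); rewrite /= ne.
    by case: posnP => [e _|_]; [rewrite /l' e mulr0 subr0 l0|apply].
  - by move=> x y; rewrite /l' ls addnC.
  - move=> a; have := min_eps (inl a); rewrite /w' /=.
    by case: (a \in A) => [|_]; [apply|rewrite mulr0 subr0].
apply: (grow_step eps_ge0 st st').
have act' : act f w' \subset A.
  apply/fintype.subsetP => a; rewrite !inE => /and3P[-> ->] /lt_le_trans; apply.
  by rewrite gerBl mulr_ge0.
clear min_c; clearbody eps; case: c den_c tight => [a|[x y]] /= den_c tight.
  apply: IH => //; rewrite -ltnS; apply: leq_trans size_n; rewrite ltnS -addnS leq_add2l.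
  apply: proper_card; apply/properP; split=> //; exists a; first by case: (a \in A) den_c.
  by rewrite inE /w' tight ltxx !andbF.
move: den_c tight; case: ifP => // ne den_c tight.
apply: (merge _ _ _ x y) => //.
by rewrite -ltnS; apply: leq_trans size_n; rewrite ltnS leq_add2l subset_leq_card.
Qed.
End Growth.
End PrizeCollecting.

(** * Tours, shortcuts and latencies *)

Section Tours.
Set Implicit Arguments.
Unset Strict Implicit.
Import fintype finset.
Local Open Scope nat_scope.
Variables (D : finType) (d : {set option D} -> nat).
Hypothesis d_metric : is_metric d.
Implicit Types (u v : option D) (p : seq (option D)) (s : seq D).

Let dist_tri u v x : dist d u x <= dist d u v + dist d v x := d_metric.2 u v x.

Lemma distC u v : dist d u v = dist d v u.
Proof. by rewrite /dist eq_sym finset.setUC. Qed.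

Lemma path_length_cat u p p' :
  path_length d u (p ++ p') = path_length d u p + path_length d (last u p) p'.
Proof. by elim: p u => //= v p IH u; rewrite IH addnA. Qed.

Lemma path_length_rev u p v :
  path_length d v (rcons (rev p) u) = path_length d u (rcons p v).
Proof.
elim: p u v => [|x p IH] u v /=; first by rewrite distC.
rewrite rev_cons -cats1 path_length_cat last_rcons IH /= addn0 distC.
by rewrite addnC.
Qed.

Lemma le_path_length_head u v p x :
  path_length d u (rcons p x) <= dist d u v + path_length d v (rcons p x).
Proof.
by case: p => [|y p] /=; rewrite ?addn0 // addnA leq_add2r.
Qed.

Lemma le_path_length_subseq u p p' x : subseq p p' ->
  path_length d u (rcons p x) <= path_length d u (rcons p' x).
Proof.
elim: p' u p => [|v p' IH] u [|y p] //=.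
  move=> _; apply: (leq_trans (le_path_length_head u v [::] x)).
  by rewrite leq_add2l; apply: (IH v [::]); rewrite sub0seq.
case: eqP => [->|_] sub; first by rewrite leq_add2l; apply: IH.
apply: (leq_trans (le_path_length_head u v (y :: p) x)).
by rewrite leq_add2l; apply: IH.
Qed.

Definition tour s : nat := path_length d None (rcons [seq Some i | i <- s] None).

Lemma le_tour_subseq s s' : subseq s s' -> tour s <= tour s'.
Proof. by move=> sub; apply: le_path_length_subseq; apply: map_subseq. Qed.

Lemma tour_rev s : tour (rev s) = tour s.
Proof. by rewrite /tour map_rev path_length_rev. Qed.

(** The client [c] is placed right after [u]. The detour from [u] to [c] and back costs twice the
    distance, and the triangle inequality skips the second visit of [u]. *)
Lemma tour_insert s u c : u \in None :: [seq Some i | i <- s] ->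
  exists s', perm_eq s' (c :: s) /\ tour s' <= tour s + 2 * dist d u (Some c).
Proof.
move=> us; have [s1 [s2 [-> ->]]] : exists s1 s2,
    s = s1 ++ s2 /\ u = last None [seq Some i | i <- s1].
  move: us; rewrite inE => /orP[/eqP->|/mapP[j js ->]]; first by exists [::], s.
  case/splitPr: js => s1 s2; exists (rcons s1 j), s2.
  by rewrite cat_rcons map_rcons last_rcons.
exists (s1 ++ c :: s2); split; first by rewrite -cat1s perm_catCA.
rewrite /tour !map_cat !rcons_cat !path_length_cat /= -addnA leq_add2l.
set u' := last _ _.
have := le_path_length_head (Some c) u' [seq Some i | i <- s2] None.
rewrite (distC (Some c)) -(leq_add2l (dist d u' (Some c))) => /leq_trans; apply.
by rewrite addnA addnC mul2n -addnn.
Qed.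

Lemma ctree_tour F E : ctree None id F E ->
  exists s, [/\ uniq s, forall j, (j \in s) = (Some j \in F) &
    tour s <= 2 * \sum_(e <- E) dist d e.1 e.2].
Proof.
elim=> [|F' E' x y tr [s [us sF le_s]] xF yF].
  by exists [::]; split=> // j; rewrite !inE.
case: y yF => [c|] yF; last by move: yF; rewrite (ctree_rootP tr).
have [|s' [perm_s' le_s']] := @tour_insert s x c.
  by case: x xF => [j|] xF; rewrite inE //= mem_map ?sF // => a b [].
exists s'; split.
- by rewrite (perm_uniq perm_s') /= us sF yF.
- by move=> j; rewrite (perm_mem perm_s') !inE sF.
- by rewrite big_cons mulnDr /= addnC; apply: (leq_trans le_s'); rewrite leq_add2r.
Qed.

Lemma latency_catl s s' j : j \in s -> latency d (s ++ s') j = latency d s j.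
Proof.
move=> js; rewrite /latency index_cat js take_cat.
case: ltnP => // h; rewrite -index_mem in js.
have e : (index j s).+1 = size s by apply/eqP; rewrite eqn_leq js h.
by rewrite e subnn take0 cats0 take_size.
Qed.

(** The concatenated route skips the return to the root between [s] and [s'], a shortcut by the
    triangle inequality. *)
Lemma latency_catr s s' j : j \notin s -> j \in s' ->
  latency d (s ++ s') j <= tour s + latency d s' j.
Proof.
move=> js js'; rewrite /latency index_cat (negbTE js) take_cat ltnNge.
rewrite leqW ?leq_addr //= -addnS addnC addnK map_cat path_length_cat.
rewrite /tour -cats1 path_length_cat /= addn0 -addnA leq_add2l.
by case: s' js' => //= a s' _; rewrite addnA leq_add2r.
Qed.

Lemma latency_split s1 s2 j : j \notin s1 ->
  latency d (s1 ++ j :: s2) j = path_length d None (rcons [seq Some i | i <- s1] (Some j)).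
Proof.
move=> js; rewrite /latency index_cat (negbTE js) /= eqxx addn0.
by rewrite take_cat ltnNge leqnSn /= subSnn /= take0 cats1 map_rcons.
Qed.

(** Reversed, the route reaches [j] along the part of the tour that the forward route leaves after
    [j]. *)
Lemma latency_rev s j : uniq s -> j \in s ->
  latency d s j + latency d (rev s) j = tour s.
Proof.
move=> us js; case/splitPr: js us => s1 s2; rewrite cat_uniq /= negb_or.
case/and4P => _ /andP[j1 _] j2 _.
rewrite latency_split // rev_cat rev_cons cat_rcons latency_split ?mem_rev //.
rewrite map_rev path_length_rev /tour map_cat rcons_cat /= path_length_cat /=.
by rewrite -cats1 path_length_cat /= addn0 addnA.
Qed.

Lemma tour_orient s : uniq s -> exists s', [/\ perm_eq s' s, tour s' = tour s &
  2 * \sum_(j <- s) latency d s' j <= size s * tour s].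
Proof.
move=> us; have sumE : \sum_(j <- s) latency d s j + \sum_(j <- s) latency d (rev s) j =
    size s * tour s.
  rewrite -big_split /= big_seq (eq_bigr (fun=> tour s)); last first.
    by move=> j js; rewrite latency_rev.
  by rewrite -big_seq big_const_seq count_predT iter_addn_0 mulnC.
case: (leqP (\sum_(j <- s) latency d s j) (\sum_(j <- s) latency d (rev s) j)) => h.
  by exists s; split=> //; rewrite -sumE mul2n -addnn leq_add2l.
exists (rev s); split; [by rewrite perm_rev|exact: tour_rev|].
by rewrite -sumE mul2n -addnn leq_add2r ltnW.
Qed.

Definition latency_on (U : {set D}) s := \sum_(j in U) latency d s j.

(** The tour [s0], shortcut to [U] and well oriented, costs its own clients half its length on
    average, while every client left for [s1] waits for all of it. After doubling, the former count
    once and the latter twice, which gives the factor [#|U|] plus the number of clients left. *)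
Lemma tour_first (U : {set D}) s0 s1 : uniq s0 -> uniq s1 ->
  (forall j, j \in s1 = (j \in U) && (j \notin s0)) ->
  exists s, [/\ uniq s, s =i U &
    2 * latency_on U s <= tour s0 * (#|U| + #|[set j in U | j \notin s0]|) +
      2 * latency_on [set j in U | j \notin s0] s1].
Proof.
move=> u0 u1 s1E; set U' := [set j in U | j \notin s0].
have [|s' [perm_s' tour_s' lat_s']] := @tour_orient [seq j <- s0 | j \in U].
  exact: filter_uniq.
have s'E j : (j \in s') = (j \in U) && (j \in s0).
  by rewrite (perm_mem perm_s') mem_filter.
exists (s' ++ s1); split.
- rewrite cat_uniq u1 (perm_uniq perm_s') filter_uniq // andbT.
  by apply/hasPn => j; rewrite s1E s'E => /andP[_ /negbTE->]; rewrite andbF.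
- by move=> j; rewrite mem_cat s'E s1E; case: (j \in U); case: (j \in s0).
have tour_le : tour s' <= tour s0 by rewrite tour_s' le_tour_subseq ?filter_subseq.
have sz : size [seq j <- s0 | j \in U] + #|U'| = #|U|.
  rewrite -(cardsID [set j in s0] U); congr (_ + _).
    rewrite -(card_uniqP (filter_uniq _ u0)); apply: eq_card => j.
    by rewrite mem_filter !inE.
  by apply: eq_card => j; rewrite !inE andbC.
rewrite /latency_on (bigID [in s0]) /= mulnDr.
have -> : \sum_(j in U | j \in s0) latency d (s' ++ s1) j =
    \sum_(j <- [seq j <- s0 | j \in U]) latency d s' j.
  rewrite [RHS]big_uniq ?filter_uniq //; apply: eq_big => j.
    by rewrite mem_filter.
  by rewrite -s'E => js; rewrite latency_catl.
have -> : tour s0 * (#|U| + #|U'|) + 2 * \sum_(j in U') latency d s1 j =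
    size [seq j <- s0 | j \in U] * tour s0 +
    2 * \sum_(j in U') (tour s0 + latency d s1 j).
  by rewrite big_split /= sum_nat_const -sz; nia.
apply: leq_add.
  by apply: (leq_trans lat_s'); rewrite leq_mul2l -tour_s' tour_le orbT.
rewrite leq_mul2l /= [leqRHS](eq_bigl (fun j => (j \in U) && (j \notin s0))).
  apply: leq_sum => j /andP[jU js]; apply: (@leq_trans (tour s' + latency d s1 j)).
    by apply: latency_catr; rewrite ?s'E ?s1E ?jU ?(negbTE js).
  by rewrite leq_add2r.
by move=> j; rewrite inE.
Qed.

End Tours.

(** * Rounding a feasible solution to a route *)

Section Rounding.
Set Implicit Arguments.
Unset Strict Implicit.
Import fintype finset.
Local Open Scope ring_scope.
Variables (R : realType) (D : finType) (d : {set option D} -> nat).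
Hypothesis d_metric : is_metric d.

(** AM-GM for [X * B] and [A * Y], whose product is [(X * Y) * (A * B)]. *)
Lemma amgm_le (A B X Y : R) : 0 < A -> 0 < B -> 0 <= X -> 0 <= Y ->
  X * B + A * Y <= 2 * A * B -> X * Y <= A * B.
Proof.
move=> A0 B0 X0 Y0 h; have AB : 0 < A * B by rewrite mulr_gt0.
rewrite -(ler_pM2l AB); have XB : 0 <= X * B by rewrite mulr_ge0 // ltW.
have AY : 0 <= A * Y by rewrite mulr_ge0 // ltW.
have := sqr_ge0 (X * B - A * Y); rewrite expr2.
have := ler_pM (addr_ge0 XB AY) (addr_ge0 XB AY) h h; lra.
Qed.

Lemma sum_pairs_edges (G : {set option D} -> R) :
  \sum_x \sum_(y | x != y) G [set x; y]%SET = 2 * \sum_(e in edges D) G e.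
Proof.
rewrite pair_big_dep /=.
rewrite (partition_big (fun p => [set p.1; p.2]%SET) (fun e => e \in edges D)) /=; last first.
  by move=> p ne; rewrite inE cards2 ne.
rewrite mulr_sumr; apply: eq_bigr => e eE.
have /cards2P[a [b [ab ->]]] : #|e| == 2%N by move: eE; rewrite inE.
have ba : b != a by rewrite eq_sym.
rewrite (bigD1 (a, b)) /=; last by rewrite ab eqxx.
rewrite (bigD1 (b, a)) /=; last first.
  by rewrite ba finset.setUC eqxx /= xpair_eqE negb_and ba.
rewrite big1 ?addr0 1?finset.setUC; last first.
  move=> [x y] /= /andP[/andP[/andP[ne /eqP e1]]].
  have := set21 x y; rewrite e1 => /set2P xE.
  have := set22 x y; rewrite e1 => /set2P yE.
  rewrite !xpair_eqE; case: xE yE ne => -> [] ->; rewrite ?eqxx //= ?eqxx //.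
by rewrite mulrDl mul1r; congr (_ + _); rewrite finset.setUC.
Qed.

Lemma sum_cut_le (G : {set option D} -> R) (S : {set D}) (S' := [set Some j | j in S]%SET) :
  (forall e, e \in edges D -> 0 <= G e) ->
  \sum_(e in cut S) G e <=
  \sum_(x in S') \sum_(y in ~: S') (if x == y then 0 else G [set x; y]%SET).
Proof.
move=> G0; rewrite pair_big_dep /=.
have ne p : (p.1 \in S') && (p.2 \in ~: S') -> p.1 != p.2.
  by rewrite inE => /andP[h1 h2]; apply: contraNneq h2 => <-.
rewrite (partition_big (fun p => [set p.1; p.2]%SET) (fun e => e \in cut S)) /=; last first.
  move=> p hp; have nep := ne _ hp; move: hp; rewrite inE => /andP[h1 h2].
  rewrite !inE cards2 nep /=; apply/cards1P; exists p.1; apply/setP => u; rewrite !inE.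
  case: (eqVneq u p.1) => [->|_] /=; first by rewrite h1.
  by case: (eqVneq u p.2) => [->|//]; rewrite (negbTE h2).
apply: ler_sum => e; rewrite inE => /andP[eE /cards1P[x eS]].
have : x \in [set x]%SET by rewrite inE.
rewrite -eS inE => /andP[xe xS]; move: (eE); rewrite inE => /cards2P[a [b [ab eab]]].
have [y yx exy] : exists2 y, x != y & e = [set x; y]%SET.
  move: xe; rewrite eab => /set2P[->|->]; first by exists b.
  by exists a; rewrite 1?eq_sym // finset.setUC.
have yS : y \notin S'.
  apply: contraNN yx => yS; have : y \in e :&: S' by rewrite inE yS exy set22.
  by rewrite eS inE eq_sym.
rewrite (bigD1 (x, y)) /=; last by rewrite inE xS yS exy eqxx.
rewrite (negbTE yx) -exy lerDl; apply: sumr_ge0 => p /andP[/andP[hp /eqP pe] _].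
by rewrite (negbTE (ne _ hp)) pe G0.
Qed.

Lemma sum_option (G : option D -> R) : \sum_a G a = G None + \sum_j G (Some j).
Proof.
rewrite (bigD1 None) //=; congr (_ + _); rewrite (reindex_omap Some id) /=; last by case.
by apply: eq_bigl => j; rewrite eqxx.
Qed.

Variables (T : nat) (x : D -> nat -> R) (z : {set option D} -> nat -> R).
Hypothesis lp : lp1_feasible d T x z.

(** The cap at [T], beyond which [x] is unconstrained, makes the function meaningful at all times
    [4 ^ i * t]. *)
Definition visited j t : R := \sum_(1 <= t' < (minn t T).+1) x j t'.
Definition unvisited t : R := \sum_j Num.max 0 (1 - visited j t).

Lemma unvisited_ge0 t : 0 <= unvisited t.
Proof. by apply: sumr_ge0 => j _; rewrite le_max lexx. Qed.

Lemma visited_homo j : {homo visited j : s t / (s <= t)%N >-> s <= t}.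
Proof.
move=> s t st; rewrite /visited [leRHS](@big_cat_nat _ _ _ (minn s T).+1) //=; last first.
  by rewrite ltnS leq_min geq_minr geq_min st.
rewrite lerDl big_nat; apply: sumr_ge0 => i /andP[h1 h2].
apply: (lp1_x_ge0 lp); apply/andP; split; first exact: leq_ltn_trans h1.
by rewrite ltnS leq_min in h2; case/andP: h2.
Qed.

Lemma unvisited_homo s t : (s <= t)%N -> unvisited t <= unvisited s.
Proof.
move=> st; apply: ler_sum => j _; rewrite ge_max !le_max lexx /=.
by rewrite lerD2l lerN2 visited_homo ?orbT.
Qed.

Lemma unvisited0 : unvisited 0 = #|D|%:R.
Proof.
rewrite /unvisited (eq_bigr (fun=> 1)) ?sumr_const ?cardT -?cardE // => j _.
rewrite /visited min0n big_geq // subr0; apply/max_idPr; exact: ler01.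
Qed.

Lemma unvisited_late t : (T <= t)%N -> unvisited t = 0.
Proof.
move=> tT; apply: big1 => j _; apply/max_idPl.
by rewrite subr_le0 /visited (minn_idPr tT); apply: (lp1_visit lp).
Qed.

(** Layer-cake summation: the unvisited part at time [t] is at most the mass of [x] after [t], and
    mass at [t'] is counted only for the times [t < t'], of which there are at most [t']. *)
Lemma sum_unvisited_le n : \sum_(0 <= t < n) unvisited t <= lp1_cost T x.
Proof.
rewrite /unvisited exchange_big /=; apply: ler_sum => j _.
have le_tail t : Num.max 0 (1 - visited j t) <=
    \sum_(1 <= t' < T.+1) (t < t')%N%:R * x j t'.
  have pos t' : (1 <= t' < T.+1)%N -> 0 <= (t < t')%N%:R * x j t'.
    by rewrite ltnS => h; apply: mulr_ge0 => //; apply: (lp1_x_ge0 lp).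
  rewrite ge_max big_nat sumr_ge0 //= -big_nat.
  rewrite lerBlDr; apply: (le_trans (lp1_visit lp j)).
  have mT : ((minn t T).+1 <= T.+1)%N by rewrite ltnS geq_minr.
  rewrite /visited (@big_cat_nat _ _ _ (minn t T).+1) //= addrC.
  apply: lerD => //; rewrite [leRHS](@big_cat_nat _ _ _ (minn t T).+1) //=.
  rewrite -[leLHS]add0r; apply: lerD.
    rewrite big_nat; apply: sumr_ge0 => t' /andP[h1 h2]; apply: pos.
    by rewrite h1; apply: leq_trans h2 mT.
  rewrite big_nat [leRHS]big_nat; apply: ler_sum => t' /andP[h1 h2].
  suff -> : (t < t')%N by rewrite mul1r.
  by move: h1 h2; rewrite gtn_min ltnS => /orP[//|] h1 h2; lia.
apply: (le_trans (ler_sum _ (fun t _ => le_tail t))).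
rewrite exchange_big /= big_nat [leRHS]big_nat; apply: ler_sum => t' /andP[h1 h2].
rewrite -mulr_suml; apply: ler_wpM2r; first by apply: (lp1_x_ge0 lp); rewrite h1.
rewrite -natr_sum ler_nat.
have sumE m : (\sum_(0 <= i < m) (i < t')%N = minn m t')%N.
  elim: m => [|m IH]; first by rewrite big_geq // min0n.
  by rewrite big_nat_recr //= IH; lia.
by rewrite sumE geq_minr.
Qed.

(** Moat growing is run on the [z] of time [minn t T] with penalty [lam / 2] everywhere. The factor
    2 on penalties restores [lam], the budget constraint gives [2 * t], and doubling the tree gives
    the tour. *)
Lemma lagrangian_tour t (lam : R) : (0 < T)%N -> (0 < t)%N -> 0 < lam ->
  exists s : seq D, uniq s /\
    (tour d s)%:R / 2 + lam * #|[set j | j \notin s]%SET|%:R <=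
      2 * t%:R + lam * unvisited t.
Proof.
move=> T0 t0 lam0; pose t1 := minn t T.
have t1T : (1 <= t1 <= T)%N by rewrite leq_min t0 T0 geq_minr.
pose q (a : option D) : R := if a is Some j then Num.max 0 (1 - visited j t) else 0.
pose zz (u v : option D) : R := if u == v then 0 else z [set u; v]%SET t1.
pose l (u v : option D) : R := (dist d u v)%:R.
have zz0 u v : 0 <= zz u v.
  rewrite /zz; case: eqP => // /eqP ne; apply: (lp1_z_ge0 lp) => //.
  by rewrite inE cards2 ne.
have zzC u v : zz u v = zz v u by rewrite /zz eq_sym finset.setUC.
have q0 a : 0 <= q a by case: a => [j|] //=; rewrite le_max lexx.
have cutq (S : {set option D}) a : None \notin S -> a \in S ->
    1 - q a <= \sum_(u in S) \sum_(v in ~: S) zz u v.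
  case: a => [j|] NS aS; last by rewrite aS in NS.
  pose S0 := [set i | Some i \in S]%SET.
  have SE : S = [set Some i | i in S0]%SET.
    apply/setP => -[i|]; last first.
      by rewrite (negbTE NS); apply/esym/negbTE/negP => /imsetP[].
    by rewrite mem_imset ?inE //; move=> ? ? [].
  have jS0 : j \in S0 by rewrite inE.
  apply: (@le_trans _ _ (visited j t)).
    by rewrite lerBlDr -lerBlDl le_max lexx orbT.
  apply: (le_trans (lp1_cut lp t1T jS0)); rewrite [in leRHS]SE.
  apply: (@sum_cut_le (fun e => z e t1)) => e eE; exact: (lp1_z_ge0 lp).
have st : stage None id l (fun=> lam / 2).
  split=> //; first by move=> u v; rewrite /l distC.
  by move=> _; apply: divr_ge0 => //; apply: ltW.
have [F [E [tr]]] := prize_collecting zz0 zzC q0 (erefl (q None)) cutq st.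
have [s [us sF le_s]] := ctree_tour d_metric tr.
rewrite /lp_value => ineq; exists s; split=> //.
have le_w : (tour d s)%:R / 2 <= weight l E.
  rewrite ler_pdivrMr // mulrC /weight -natr_sum -natrM ler_nat; exact: le_s.
have le_c : (#|[set j | j \notin s]%SET| <= #|labels id :\: F|)%N.
  have someI : injective (@Some D) by move=> i j [].
  rewrite -(card_imset _ someI); apply: subset_leq_card.
  by apply/fintype.subsetP => _ /imsetP[j js ->]; move: js; rewrite !inE sF eqxx andbT.
have budget : \sum_u \sum_(v | u != v) l u v * zz u v <= 2 * t%:R.
  have := sum_pairs_edges (fun e => (d e)%:R * z e t1).
  have -> : \sum_u \sum_(v | u != v) (d [set u; v]%SET)%:R * z [set u; v]%SET t1 =
      \sum_u \sum_(v | u != v) l u v * zz u v.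
    apply: eq_bigr => u _; apply: eq_bigr => v ne.
    by rewrite /l /zz /dist (negbTE ne).
  move=> ->; apply: ler_wpM2l => //; apply: (le_trans (lp1_budget lp t1T)).
  by rewrite ler_nat geq_minl.
have qE : \sum_(a in labels id) lam / 2 * q a = lam / 2 * unvisited t.
  rewrite -mulr_sumr (eq_bigl predT) => [|a]; last by rewrite !inE eqxx.
  by rewrite sum_option add0r.
rewrite qE sumr_const -mulr_natr in ineq.
have le_c' : lam * #|[set j | j \notin s]%SET|%:R <= lam * #|labels id :\: F|%:R.
  by apply: ler_wpM2l; rewrite ?ler_nat // ltW.
lra.
Qed.

(* By AM-GM, the choice [lam = (2t + b) / (g + n)] turns the Lagrangian bound
   into a bound on a product. *)
Lemma product_tour t n (b : R) : (0 < T)%N -> (0 < t)%N -> (0 < n)%N -> 0 <= b ->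
  exists s : seq D, uniq s /\
    ((tour d s)%:R / 2 + b) * (#|[set j | j \notin s]%SET|%:R + n%:R) <=
      (2 * t%:R + b) * (unvisited t + n%:R).
Proof.
move=> T0 t0 n0 b0.
have n0' : 0 < n%:R :> R by rewrite ltr0n.
have t0' : 0 < t%:R :> R by rewrite ltr0n.
have g0 := unvisited_ge0 t.
set A := 2 * t%:R + b; set B := unvisited t + n%:R.
have A0 : 0 < A by rewrite /A; lra.
have B0 : 0 < B by rewrite /B; lra.
have [s [us]] := lagrangian_tour T0 t0 (divr_gt0 A0 B0).
set c := (tour d s)%:R / 2; set m := #|_|%:R => ineq; exists s; split=> //.
have lamB : A / B * B = A by rewrite divfK ?gt_eqF.
have {ineq} ineq : (c + b) * B + A * (m + n%:R) <= 2 * A * B.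
  set lam := A / B in lamB ineq.
  have h : c + b + lam * (m + n%:R) <= 2 * A.
    have lamB' : lam * unvisited t + lam * n%:R = A by rewrite -mulrDr.
    have AE : A = 2 * t%:R + b by [].
    rewrite mulrDr; lra.
  by have := ler_wpM2r (ltW B0) h; rewrite mulrDl mulrAC lamB.
by apply: amgm_le ineq => //; rewrite /c ?addr_ge0 ?divr_ge0.
Qed.

Lemma covering_tour : (0 < T)%N -> exists s : seq D, [/\ uniq s, forall j, j \in s &
  (tour d s)%:R <= 4 * T%:R :> R].
Proof.
(* Nothing is unvisited at time [T], so a penalty above [2 * T] leaves no room for even one missed
   client. *)
move=> T0; have lam0 : 0 < 2 * T%:R + 1 :> R by rewrite ltr_wpDl.
have [s [us]] := lagrangian_tour T0 T0 lam0; rewrite unvisited_late // mulr0 addr0.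
set m := #|_| => ineq; have t0 : 0 <= (tour d s)%:R :> R by [].
have m0 : m = 0%N.
  apply/eqP; rewrite -leqn0 -ltnS -(ltr_nat R).
  by rewrite -(ltr_pM2l lam0) mulr1; lra.
exists s; split=> // [j|]; last by move: ineq; rewrite m0; lra.
apply/negPn/negP => js; have : j \in [set j | j \notin s]%SET by rewrite inE.
by rewrite (card0_eq m0) inE.
Qed.

Lemma staged_route t n (U : {set D}) : (0 < T)%N -> (0 < t)%N -> (T <= t * 4 ^ n)%N ->
  exists s, [/\ uniq s, s =i U & (latency_on d U s)%:R <=
    2 * t%:R * #|U|%:R +
    10 * \sum_(0 <= i < n) (t * 4 ^ i)%N%:R * unvisited (t * 4 ^ i) :> R].
Proof.
move=> T0; elim: n t U => [|n IH] t U t0 Tt.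
  have [s0 [us0 s0E le0]] := covering_tour T0.
  have [|s [us sE le_s]] := @tour_first _ d d_metric U s0 [::] us0 isT.
    by move=> j; rewrite s0E andbF.
  exists s; split=> //; rewrite big_geq // mulr0 addr0.
  have e0 : [set j in U | j \notin s0]%SET = finset.set0.
    by apply/setP => j; rewrite !inE s0E andbF.
  move: le_s; rewrite e0 cards0 addn0 /(latency_on d finset.set0 _) big_set0 muln0 addn0.
  rewrite -(ler_nat R) !natrM => le_s.
  have Tt' : T%:R <= t%:R :> R by rewrite ler_nat; move: Tt; rewrite muln1.
  have U0 : 0 <= #|U|%:R :> R by [].
  have := ler_wpM2r U0 (le_trans le0 (ler_wpM2l (ler0n R 4) Tt')).
  lra.
case: (posnP #|U|) => [U0|U0].
  exists [::]; split=> //; first by move=> j; rewrite (card0_eq U0) !inE.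
  rewrite /latency_on big_pred0; last exact: card0_eq.
  apply: addr_ge0; first by rewrite mulr_ge0.
  rewrite mulr_ge0 //; apply: sumr_ge0 => i _; rewrite mulr_ge0 //; exact: unvisited_ge0.
(* The induction hypothesis at [4 * t] charges [b = 8 * t] per client left. With [g] for
   [unvisited t], [product_tour] gives [10 * t * (g + #|U|)]; subtracting the [8 * t * #|U|] that it
   includes leaves [2 * t * #|U| + 10 * t * g], so the coefficient 2 reproduces itself. *)
have b0 : 0 <= 2 * (4 * t)%N%:R :> R by rewrite mulr_ge0.
have [s0 [us0 prod]] := product_tour T0 t0 U0 b0.
have [|| s1 [us1 s1E le1]] := IH (4 * t)%N [set j in U | j \notin s0]%SET.
- by rewrite muln_gt0.
- by move: Tt; rewrite expnS mulnA [(t * 4)%N]mulnC.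
have [|s [us sE le_s]] := @tour_first _ d d_metric U s0 s1 us0 us1.
  by move=> j; rewrite s1E inE.
exists s; split=> //.
rewrite big_nat_recl // expn0 muln1 mulrDr.
have -> : \sum_(0 <= i < n) (t * 4 ^ i.+1)%N%:R * unvisited (t * 4 ^ i.+1) =
   \sum_(0 <= i < n) (4 * t * 4 ^ i)%N%:R * unvisited (4 * t * 4 ^ i).
  by apply: eq_bigr => i _; rewrite expnS mulnA [(t * 4)%N]mulnC.
move: le1 le_s; set W := \sum_(0 <= i < n) _; set U' := [set j in U | _]%SET => le1.
rewrite -(ler_nat R) natrD !natrM natrD => le_s.
have le_m : #|U'|%:R <= #|[set j | j \notin s0]%SET|%:R :> R.
  by rewrite ler_nat; apply: subset_leq_card; apply/fintype.subsetP => j; rewrite !inE => /andP[].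
have tau0 : 0 <= (tour d s0)%:R :> R by [].
move: prod le1; rewrite natrM; move: le_m; set m := #|[set j | j \notin s0]%SET|%:R => le_m.
have h1 := ler_wpM2l tau0 le_m.
have t0' : 0 <= t%:R :> R by [].
have h2 := ler_wpM2l t0' le_m.
lra.
Qed.

(** Since [unvisited] is nonincreasing, the term at [2 ^ k.+1] is at most twice the sum over the
    [2 ^ k] times in the dyadic block ending there. Time 0 lies in no block, and its value [#|D|] is
    subtracted from the cost. *)
Lemma staged_sum_le n :
  \sum_(0 <= k < n) (2 ^ k)%N%:R * unvisited (2 ^ k) <=
  2 * (lp1_cost T x - #|D|%:R).
Proof.
have aux m : \sum_(0 <= k < m.+1) (2 ^ k)%N%:R * unvisited (2 ^ k) <=
    2 * \sum_(1 <= t < (2 ^ m).+1) unvisited t.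
  elim: m => [|m IH].
    rewrite !big_nat1 expn0 mul1r; have := unvisited_ge0 1; lra.
  rewrite big_nat_recr //= [in leRHS](@big_cat_nat _ _ _ (2 ^ m).+1) //=; last first.
    by rewrite ltnS leq_exp2l.
  rewrite mulrDr; apply: lerD => //.
  apply: (@le_trans _ _ (2 * \sum_((2 ^ m).+1 <= t < (2 ^ m.+1).+1) unvisited (2 ^ m.+1))).
    have e : ((2 ^ m.+1).+1 - (2 ^ m).+1 = 2 ^ m)%N.
      by rewrite subSS expnS mul2n -addnn addnK.
    by rewrite sumr_const_nat e -[unvisited _ *+ _]mulr_natl mulrA -natrM -expnS.
  apply: ler_wpM2l => //; rewrite [leLHS]big_nat [leRHS]big_nat; apply: ler_sum => t /andP[_ h].
  exact: unvisited_homo.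
have := sum_unvisited_le (2 ^ n).+1; rewrite big_nat_recl // unvisited0.
rewrite -(big_add1 _ _ 0 (2 ^ n).+1 predT unvisited) /= => le_cost.
have {aux} := aux n; rewrite big_nat_recr //= => aux.
have := mulr_ge0 (ler0n R (2 ^ n)) (unvisited_ge0 (2 ^ n)).
lra.
Qed.

Lemma lp_route : exists s, is_route s /\
  (total_latency d s)%:R <= 10 * lp1_cost T x :> R.
Proof.
case: (posnP #|D|) => [D0|D0].
  exists [::]; split; first by split=> // j; have := card0_eq D0 j; rewrite inE.
  rewrite /total_latency /lp1_cost !big_pred0 ?mulr0 //; exact: card0_eq.
have T0 : (0 < T)%N.
  case/card_gt0P: D0 => j _; rewrite lt0n; apply/eqP => Te.
  by have := lp1_visit lp j; rewrite Te big_geq // ler10.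
have big t : (0 < t)%N -> (T <= t * 4 ^ T)%N.
  move=> t0; apply: (leq_trans (ltnW (ltn_expl T (isT : (1 < 4)%N)))).
  by rewrite leq_pmull.
have [s1 [us1 s1E le1]] := staged_route finset.setT T0 (isT : (0 < 1)%N) (big 1%N isT).
have [s2 [us2 s2E le2]] := staged_route finset.setT T0 (isT : (0 < 2)%N) (big 2%N isT).
have route s : uniq s -> s =i [set: D]%SET -> is_route s.
  by move=> us sE; split=> // j; rewrite sE inE.
have totE s : latency_on d [set: D]%SET s = total_latency d s.
  by apply: eq_bigl => j; rewrite inE.
rewrite !totE cardsT in le1 le2.
(* Even powers of 2 are the stages of the route started at 1, odd powers those of the route started
   at 2. *)
have split_sum : \sum_(0 <= k < T.*2) (2 ^ k)%N%:R * unvisited (2 ^ k) =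
    \sum_(0 <= i < T) (1 * 4 ^ i)%N%:R * unvisited (1 * 4 ^ i) +
    \sum_(0 <= i < T) (2 * 4 ^ i)%N%:R * unvisited (2 * 4 ^ i).
  elim: (T) => [|m IH]; first by rewrite !big_geq // addr0.
  rewrite doubleS !big_nat_recr //= IH expnS -muln2 mulnC expnM mul1n; ring.
have := staged_sum_le T.*2; rewrite split_sum => le3.
case: (lerP (total_latency d s1)%:R (10 * lp1_cost T x)) => h1.
  by exists s1; split=> //; apply: route.
exists s2; split; first exact: route.
(* The two routes together cost at most [6 * #|D| + 20 * (lp1_cost T x - #|D|)], hence at most
   [20 * lp1_cost T x]; if the first exceeds half of this, the second does not. *)
have := ler0n R #|D|; lra.
Qed.

End Rounding.

Theorem theorem3p1 (R : realType) (D : finType) (d : {set option D} -> nat)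
    (T : nat) (hd : is_metric d)
    (hT : exists s : seq D,
        is_optimal_route d s /\ forall j : D, latency d s j <= T) :
  (ml_opt R d <= (1078%:R / 100%:R)%:E * lp1_opt R d T)%E.
Proof.
have k_gt0 : (0 < 1078%:R / 100%:R :> R)%R by rewrite divr_gt0 ?ltr0n.
rewrite -lee_pdivrMl //; apply: le_ereal_inf_tmp => _ [x [z [lp ->]]].
rewrite lee_pdivrMl //.
have [s [route le_s]] := lp_route hd lp.
apply: (@le_trans _ _ (total_latency d s)%:R%:E).
  by apply: ereal_inf_lbound; exists s.
rewrite -EFinM lee_fin; apply: (le_trans le_s).
(* Nonnegativity of the cost allows the factor 10 to be relaxed to 10.78. *)
have cost_ge0 : (0 <= lp1_cost T x)%R.
  rewrite /lp1_cost; apply: sumr_ge0 => j _; rewrite big_nat; apply: sumr_ge0 => t ht.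
  by rewrite mulr_ge0 // (lp1_x_ge0 lp).
by rewrite ler_wpM2r // ler_pdivlMr ?ltr0n // -natrM ler_nat.
Qed.
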